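(* Let $\mathcal T_1=(S_1,\Sigma_1,\kappa_1)$ and $\mathcal T_2=(S_2,\Sigma_2,\kappa_2)$ be stochastic transition systems and $\alpha:(S_1,\Sigma_1)\to(S_2,\Sigma_2)$ a measurable function. If $\mathcal T_2$ is a sound $\alpha$-abstraction of $\mathcal T_1$ and $A\in\Sigma_2$ is an attractor for $\mathcal T_2$, then $\alpha^{-1}(A)$ is an attractor for $\mathcal T_1$.
   Context: A stochastic transition system (STS) is $\mathcal T=(S,\Sigma,\kappa)$ where $(S,\Sigma)$ is a measurable space and $\kappa:S\times\Sigma\to[0,1]$ is a Markov kernel. $\mathrm{Dist}(S)$ is the set of probability measures on $(S,\Sigma)$. For $\mu\in\mathrm{Dist}(S)$, $\mathrm{Prob}^{\mathcal T}_\mu$ is the law on infinite paths $s_0s_1\dots\in S^\omega$ (cylinder $\sigma$-algebra) of the Markov chain with initial distribution $\mu$ and kernel $\kappa$. $\mathbf F B$ is the event $\exists i\ge0,\ s_i\in B$. $B\in\Sigma$ is an attractor for $\mathcal T$ if $\mathrm{Prob}^{\mathcal T}_\mu(\mathbf F B)=1$ for every $\mu\in\mathrm{Dist}(S)$. $\Omega_{\mathcal T}(\mu)\in\mathrm{Dist}(S)$ is defined by $\Omega_{\mathcal T}(\mu)(A)=\int_S\kappa(s,A)\,\mu(\mathrm ds)$. The pushforward is $\alpha_\#(\mu)(M)=\mu(\alpha^{-1}(M))$. $\mathcal T_2$ is an $\alpha$-abstraction of $\mathcal T_1$ if for every $\mu\in\mathrm{Dist}(S_1)$ the measures $\alpha_\#(\Omega_{\mathcal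 T_1}(\mu))$ and $\Omega_{\mathcal T_2}(\alpha_\#(\mu))$ have the same null sets. It is sound if for every $\mu\in\mathrm{Dist}(S_1)$ and every $B\in\Sigma_2$: $\mathrm{Prob}^{\mathcal T_2}_{\alpha_\#(\mu)}(\mathbf F B)=1$ implies $\mathrm{Prob}^{\mathcal T_1}_\mu(\mathbf F\alpha^{-1}(B))=1$. *)

(* Defs.v *)
From HB Require Import structures.
From mathcomp Require Import all_boot all_order all_algebra.
From mathcomp Require Import zify.
From mathcomp Require Import all_classical all_reals all_analysis measurable_realfun.

Set Implicit Arguments.
Unset Strict Implicit.
Unset Printing Implicit Defensive.
Import Order.TTheory GRing.Theory Num.Theory.
Local Open Scope classical_set_scope.
Local Open Scope ring_scope.
Local Open Scope ereal_scope.

Section path_space.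
Context d (S : measurableType d).

Definition coordinate_sets : set (set (nat -> S)) :=
  [set E | exists i (B : set S),
     measurable B /\ E = (fun x : nat -> S => x i) @^-1` B].

Definition path_space : measurableType (coordinate_sets.-sigma) :=
  g_sigma_algebraType coordinate_sets.

Definition eventually_in (B : set S) : set path_space :=
  [set x : nat -> S | exists i, B (x i)].

Lemma measurable_coordinate (i : nat) :
  measurable_fun [set: path_space] (fun x : path_space => x i).
Proof.
move=> _ B mB; rewrite setTI; apply: sub_sigma_algebra.
by exists i, B.
Qed.

Lemma measurable_eventually_in (B : set S) :
  measurable B -> measurable (eventually_in B).
Proof.
move=> mB.
rewrite (_ : eventually_in B = \bigcup_i ((fun x : path_space => x i) @^-1` B)).
  apply: bigcupT_measurable => i; rewrite -[X in measurable X]setTI.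
  exact: measurable_coordinate.
by apply/seteqP; split => x [i]; [exists i|move=> _ Bx; exists i].
Qed.

Lemma measurable_rectangle n (A : nat -> set S) : (forall i, measurable (A i)) ->
  measurable ([set x : nat -> S | forall i, (i <= n)%N -> A i (x i)] :
    set path_space).
Proof.
move=> mA; rewrite [X in measurable X](_ : _ =
  \bigcap_(i in [set i | (i <= n)%N]) ((fun x : path_space => x i) @^-1` A i)).
  apply: bigcap_measurable => [|i _]; first by exists 0%N.
  by rewrite -[X in measurable X]setTI; exact: measurable_coordinate.
by apply/seteqP; split => x /= Ax i; exact: Ax.
Qed.

Lemma measurable_to_path_space d' (T : measurableType d') (f : T -> path_space) :
  (forall i, measurable_fun [set: T] (fun t => f t i)) ->
  measurable_fun [set: T] f.
Proof.
move=> mf; apply: (@measurability _ _ T path_space setT f coordinate_sets) => //.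
move=> _ [_ [i [B [mB ->]]] <-].
exact: (mf i measurableT B mB).
Qed.

End path_space.
Arguments path_space {d} S.

Section chain.
Context d (S : measurableType d) (R : realType).
Variable kappa : R.-pker S ~> S.

(* Probability that the chain started at [s] satisfies
   [s_1 \in A 0, ..., s_n \in A (n-1)]. *)
Fixpoint chain_prob (n : nat) (A : nat -> set S) (s : S) : \bar R :=
  if n is m.+1 then
    \int[kappa s]_(t in A 0%N) chain_prob m (fun i => A i.+1) t
  else 1.

(* The finite-dimensional distributions of the Markov chain with initial law
   [mu]: P(s_0 \in A_0, ..., s_n \in A_n) is
   int_{A_0} mu(ds_0) int_{A_1} kappa(s_0, ds_1) ... int_{A_n} kappa(s_{n-1}, ds_n).
   By [ionescu_tulcea] and [is_path_law_unique] below they determine exactly one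
   probability measure on the path space. *)
Definition is_path_law (mu : probability S R) (P : probability (path_space S) R) :=
  forall (n : nat) (A : nat -> set S), (forall i, measurable (A i)) ->
    P [set x : nat -> S | forall i, (i <= n)%N -> A i (x i)] =
    \int[mu]_(s in A 0%N) chain_prob n (fun i => A i.+1) s.

End chain.

(* Existence and uniqueness of the path law, over an arbitrary measurable state
   space. The content of a cylinder set is an iterated integral;
   sigma-subadditivity is proved by contradiction: if E is covered by the F_i and
   P(E) > sum_i P(F_i), successive choices of s_0, s_1, ... keep the same strict
   inequality between conditional probabilities given s_0 ... s_k for all k, and
   the resulting path is in E but in none of the F_i. *)
Section ionescu_tulcea.
Context d (S : measurableType d) (R : realType).
Variable kappa : R.-pker S ~> S.
Notation path := (path_space S).

Let coord_kernel (k : nat) (x : path) : {measure set S -> \bar R} := kappa (x k).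

Let coord_kernel_measurable k U : measurable U ->
  measurable_fun [set: path] (coord_kernel k ^~ U).
Proof.
move=> mU; apply: (measurableT_comp (measurable_kernel kappa U mU)).
exact: measurable_coordinate.
Qed.

HB.instance Definition _ k := isKernel.Build _ _ path S R (coord_kernel k)
  (@coord_kernel_measurable k).

Let coord_kernel_uub k : measure_fam_uub (coord_kernel k).
Proof.
exists 2%R => x; rewrite /coord_kernel prob_kernel.
by rewrite lte_fin ltr1n.
Qed.

HB.instance Definition _ k := Kernel_isFinite.Build _ _ path S R (coord_kernel k)
  (@coord_kernel_uub k).

Let upd (x : path) (k : nat) (s : S) : path := fun i => if i == k then s else x i.

(* Conditional expectation given the coordinates 0..k of a functional depending on
   the coordinates 0..k+1. *)
Let step (k : nat) (f : path -> \bar R) (x : path) : \bar R :=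
  \int[kappa (x k)]_s f (upd x k.+1 s).

Let measurable_upd k : measurable_fun [set: path * S] (fun z => upd z.1 k z.2).
Proof.
apply: measurable_to_path_space => i; rewrite /upd.
case: eqP => _; first exact: measurable_snd.
by apply: (measurableT_comp (measurable_coordinate i)); exact: measurable_fst.
Qed.

Let measurable_upd2 x k : measurable_fun [set: S] (upd x k).
Proof.
apply: measurable_to_path_space => i; rewrite /upd.
case: eqP => _; [exact: measurable_id | exact: measurable_cst].
Qed.

Let nnmeas (f : path -> \bar R) :=
  (forall x, 0 <= f x) /\ measurable_fun [set: path] f.

Let step_nnmeas k f : nnmeas f -> nnmeas (step k f).
Proof.
move=> [f0 mf]; split=> [x|]; first exact: integral_ge0.
rewrite /step.
apply: (measurable_fun_integral_finite_kernel
  (fun z : path * S => f (upd z.1 k.+1 z.2)) (coord_kernel k)) => //.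
by apply: (measurableT_comp mf); exact: measurable_upd.
Qed.

(* [f] depends only on the coordinates 0..n. *)
Let dep (T : Type) (n : nat) (f : path -> T) :=
  forall x y : path, (forall i, (i <= n)%N -> x i = y i) -> f x = f y.

Let dep_le T m n (f : path -> T) : (m <= n)%N -> dep m f -> dep n f.
Proof.
by move=> mn df x y xy; apply: df => i im; apply: xy; exact: leq_trans mn.
Qed.

Let step_dep k f : dep k.+1 f -> dep k (step k f).
Proof.
move=> df x y xy; rewrite /step xy//; apply: eq_integral => s _.
by apply: df => i ik; rewrite /upd; case: eqP => // /eqP ?; apply: xy; lia.
Qed.

Let step_id k f : dep k f -> step k f = f.
Proof.
move=> df; apply/funext => x; rewrite /step.
under eq_integral => s _.
  rewrite (df _ x); last by move=> i ik; rewrite /upd; case: eqP => // ?; lia.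
  over.
by rewrite integral_cst// prob_kernel mule1.
Qed.

Fixpoint iter_step (k m : nat) (f : path -> \bar R) : path -> \bar R :=
  if m is m'.+1 then step k (iter_step k.+1 m' f) else f.

Let iter_nnmeas k m f : nnmeas f -> nnmeas (iter_step k m f).
Proof. by move=> nf; elim: m k => //= m IH k; exact: step_nnmeas. Qed.

Let iter_dep k m f : dep (k + m) f -> dep k (iter_step k m f).
Proof.
elim: m k => [|m IH] k /=; first by rewrite addn0.
by rewrite addnS -addSn => /IH; exact: step_dep.
Qed.

Let iter_stable k m m' f n : dep n f -> (n <= k + m)%N -> (n <= k + m')%N ->
  iter_step k m f = iter_step k m' f.
Proof.
move=> df.
suff H j k0 : (n <= k0 + j)%N -> iter_step k0 j f = iter_step k0 (n - k0) f.
  by move=> /H -> /H ->.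
elim: j k0 => [|j IH] k0 /=.
  by rewrite addn0 -subn_eq0 => /eqP ->.
rewrite addnS -addSn => nk; rewrite (IH _ nk).
have [kn|kn] := ltnP k0 n; first by rewrite -[in RHS](subnSK kn).
have -> : (n - k0.+1 = 0)%N by lia.
have -> : (n - k0 = 0)%N by lia.
by apply: step_id; exact: dep_le df.
Qed.

Let indE (E : set path) (x : path) : \bar R := (\1_E x)%:E.

Let cyl (E : set path) := measurable E /\ exists n, dep n E.

Let depth (E : set path) : nat := xget 0%N [set n | dep n E].

Let depthP E : cyl E -> dep (depth E) E.
Proof. by move=> [_ [n dn]]; exact: (@xgetPex _ 0%N [set m | dep m E] (ex_intro _ n dn)). Qed.

Let indE_dep n E : dep n E -> dep n (indE E).
Proof.
move=> dE x y xy; rewrite /indE !indicE.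
by congr ((_ : bool)%:R%:E); apply/idP/idP; rewrite !inE (dE x y).
Qed.

Let indE_nnmeas E : measurable E -> nnmeas (indE E).
Proof.
move=> mE; split => [x|]; first by rewrite lee_fin indicE ler0n.
exact/measurable_EFinP/measurable_indic.
Qed.

(* Conditional probability of the cylinder set [E] given the coordinates 0..k. *)
Let cond (k : nat) (E : set path) := iter_step k (depth E) (indE E).

Let condE k E n m : cyl E -> dep n E -> (n <= k + m)%N ->
  cond k E = iter_step k m (indE E).
Proof.
move=> cE dn nk; rewrite /cond.
have /indE_dep d1 := depthP cE; have /indE_dep d2 := dn.
pose p := (k + m + depth E)%N.
transitivity (iter_step k p (indE E)).
  by apply: (iter_stable d1); rewrite /p; lia.
by apply: (iter_stable d2); rewrite /p; lia.
Qed.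

Let cond_nnmeas k E : cyl E -> nnmeas (cond k E).
Proof. by move=> [mE _]; apply: iter_nnmeas; exact: indE_nnmeas. Qed.

Let cond_dep k E : cyl E -> dep k (cond k E).
Proof.
move=> cE; apply: iter_dep; apply: dep_le (indE_dep (depthP cE)); lia.
Qed.

Let cond_step k E : cyl E -> cond k E = step k (cond k.+1 E).
Proof.
move=> cE; rewrite (condE (m := (depth E).+1) cE (depthP cE)); last lia.
by rewrite (condE (k := k.+1) (m := depth E) cE (depthP cE))//; lia.
Qed.

Let cond_ind k E n : cyl E -> dep n E -> (n <= k)%N -> cond k E = indE E.
Proof. by move=> cE dn nk; rewrite (condE (m := 0%N) cE dn)//; lia. Qed.

Let iter_add k m f g : nnmeas f -> nnmeas g ->
  iter_step k m (f \+ g) = iter_step k m f \+ iter_step k m g.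
Proof.
move=> nf ng; elim: m k => //= m IH k; apply/funext => x.
rewrite IH /step /=.
have [f0 mf] := iter_nnmeas k.+1 m nf; have [g0 mg] := iter_nnmeas k.+1 m ng.
rewrite ge0_integralD//.
- exact: (measurableT_comp mf).
- exact: (measurableT_comp mg).
Qed.

Let cylC E : cyl E -> cyl (~` E).
Proof.
move=> [mE [n dn]]; split; first exact: measurableC.
by exists n => x y xy; rewrite /setC/= (dn x y).
Qed.

Let cylU E F : cyl E -> cyl F -> cyl (E `|` F).
Proof.
move=> [mE [n dn]] [mF [m dm]]; split; first exact: measurableU.
exists (maxn n m) => x y xy; rewrite /setU/=.
rewrite (dn x y); last by move=> i ni; apply: xy; lia.
by rewrite (dm x y)//; move=> i ni; apply: xy; lia.
Qed.

Let cyl0 : cyl set0.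
Proof. by split => //; exists 0%N => x y. Qed.

Let cond_add k (A B : set path) : cyl A -> cyl B -> A `&` B = set0 ->
  cond k (A `|` B) = cond k A \+ cond k B.
Proof.
move=> cA cB AB0; have cAB := cylU cA cB.
pose n := (depth A + depth B + depth (A `|` B))%N.
rewrite (condE (m := n) cA (depthP cA)); last by rewrite /n; lia.
rewrite (condE (m := n) cB (depthP cB)); last by rewrite /n; lia.
rewrite (condE (m := n) cAB (depthP cAB)); last by rewrite /n; lia.
rewrite -iter_add; [|exact: indE_nnmeas cA.1|exact: indE_nnmeas cB.1].
congr (iter_step _ _ _); apply/funext => x; rewrite /indE !indicE in_setU.
have [xA|xA] := boolP (x \in A); have [xB|xB] := boolP (x \in B) => /=;
  rewrite -EFinD ?addr0 ?add0r//.
by have : set0 x by rewrite -AB0; split; exact: set_mem.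
Qed.

Definition cylinder_algebra := (nat -> S).
Definition cylinder_display : measure_display. Proof. by constructor. Qed.
HB.instance Definition _ := Pointed.on cylinder_algebra.
HB.instance Definition _ := isAlgebraOfSets.Build cylinder_display
  cylinder_algebra cyl0 cylU cylC.

Variable mu : probability S R.

Let konst (s : S) : path := fun=> s.
Let measurable_konst : measurable_fun [set: S] konst.
Proof. by apply: measurable_to_path_space => i; exact: measurable_id. Qed.

Definition cyl_content (E : set cylinder_algebra) : \bar R :=
  \int[mu]_s cond 0 E (konst s).

Let content_ge0 E : 0 <= cyl_content E.
Proof.
apply: integral_ge0 => s _; rewrite /cond.
have : forall x, 0 <= indE E x by move=> x; rewrite lee_fin indicE ler0n.
elim: (depth E) 0%N (konst s) => //= m IH k x E0.
by apply: integral_ge0 => t _; exact: IH.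
Qed.

Let cond0 k : cond k set0 = cst 0.
Proof.
rewrite (cond_step _ cyl0).
have -> : cond k.+1 set0 = cst 0.
  rewrite (cond_ind cyl0 (n := 0%N))//; first by apply/funext => x; rewrite /indE indic0.
by apply/funext => x; rewrite /step integral0.
Qed.

Let content0 : cyl_content set0 = 0.
Proof. by rewrite /cyl_content cond0 integral0. Qed.

Let content_additive : measure_function.semi_additive cyl_content.
Proof.
apply/(additive2P content0) => A B cA cB AB0.
have nA : nnmeas (cond 0 A) by exact: cond_nnmeas.
have nB : nnmeas (cond 0 B) by exact: cond_nnmeas.
have condAB := cond_add 0 cA cB AB0.
rewrite /cyl_content condAB ge0_integralD//=.
- by move=> s _; exact: nA.1.
- by apply: (measurableT_comp nA.2).
- by move=> s _; exact: nB.1.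
- by apply: (measurableT_comp nB.2).
Qed.

HB.instance Definition _ := isContent.Build cylinder_display cylinder_algebra R
  cyl_content content_ge0 content_additive.

Let witness (nu : {measure set S -> \bar R}) (g : S -> \bar R)
    (h : nat -> S -> \bar R) :
  (forall s, 0 <= g s) -> measurable_fun [set: S] g ->
  (forall i s, 0 <= h i s) -> (forall i, measurable_fun [set: S] (h i)) ->
  \sum_(i <oo) \int[nu]_s h i s < \int[nu]_s g s ->
  exists s, \sum_(i <oo) h i s < g s.
Proof.
move=> g0 mg h0 mh hg; apply: contrapT => /forallNP H.
move: hg; apply/negP; rewrite -leNgt -integral_nneseries//.
apply: ge0_le_integral => //.
- by apply: ge0_emeasurable_sum => // i s _ _.
- by move=> s _; rewrite leNgt; apply/negP/H.
Qed.

Let content_subadditive : measurable_subset_sigma_subadditive cyl_content.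
Proof.
move=> E F cF cE EF; rewrite leNgt; apply/negP => FE.
pose Q k x := \sum_(i <oo) cond k (F i) x < cond k E x.
have [s0 Q0] : exists s, Q 0%N (konst s).
  apply: (witness _ _ _ _ FE) => [s||i s|i].
  - exact: (cond_nnmeas 0 cE).1.
  - exact: (measurableT_comp (cond_nnmeas 0 cE).2).
  - exact: (cond_nnmeas 0 (cF i)).1.
  - exact: (measurableT_comp (cond_nnmeas 0 (cF i)).2).
have QS (kx : nat * path) : exists s, Q kx.1 kx.2 -> Q kx.1.+1 (upd kx.2 kx.1.+1 s).
  case: kx => k x /=; have [Qk|nQk] := pselect (Q k x); last by exists point.
  suff [s Qs] : exists s, Q k.+1 (upd x k.+1 s) by exists s.
  apply: (@witness (kappa (x k))) => [s||i s|i|].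
  - exact: (cond_nnmeas k.+1 cE).1.
  - exact: (measurableT_comp (cond_nnmeas k.+1 cE).2).
  - exact: (cond_nnmeas k.+1 (cF i)).1.
  - exact: (measurableT_comp (cond_nnmeas k.+1 (cF i)).2).
  - move: Qk; rewrite /Q (cond_step k cE).
    by under eq_eseriesr => i _ do rewrite (cond_step k (cF i)).
have [nxt Qnxt] := choice QS.
pose xs := fix xs (k : nat) : path :=
  if k is j.+1 then upd (xs j) j.+1 (nxt (j, xs j)) else konst s0.
have Qxs k : Q k (xs k) by elim: k => //= k; exact: (Qnxt (k, xs k)).
pose y : path := fun i => xs i i.
have xsy k i : (i <= k)%N -> xs k i = y i.
  elim: k => [|k IH]; first by rewrite leqn0 => /eqP ->.
  rewrite leq_eqVlt => /predU1P[-> //|ik] /=.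
  by rewrite {1}/upd ltn_eqF// IH.
have Qy k : Q k y.
  move: (Qxs k); rewrite /Q (cond_dep cE (xsy k)).
  by under eq_eseriesr => i _ do rewrite (cond_dep (cF i) (xsy k)).
have ge0F k i : 0 <= cond k (F i) y by exact: (cond_nnmeas k (cF i)).1.
have Ey : E y.
  have := Qy (depth E); rewrite /Q (cond_ind cE (depthP cE) (leqnn _)).
  move=> /(le_lt_trans (nneseries_ge0 (fun i _ _ => ge0F _ i))).
  by rewrite lte_fin indicE; case: (boolP (y \in E)) => [/set_mem//|_]; rewrite ltxx.
have [j _ Fjy] := EF _ Ey.
have := Qy (maxn (depth E) (depth (F j))); apply/negP; rewrite -leNgt.
rewrite (cond_ind cE (depthP cE)); last lia.
set k := maxn _ _.
apply: (@le_trans _ _ (cond k (F j) y)).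
  rewrite (cond_ind (cF j) (depthP (cF j))); last by rewrite /k; lia.
  by rewrite /indE !indicE !mem_set.
apply: (@le_trans _ _ (\sum_(0 <= i < j.+1) cond k (F i) y)).
  by rewrite big_nat_recr//= leeDr// sume_ge0.
exact: nneseries_lim_ge.
Qed.

HB.instance Definition _ := Content_SigmaSubAdditive_isMeasure.Build
  cylinder_display R cylinder_algebra cyl_content content_subadditive.

Definition cyl_extension : set path -> \bar R := measure_extension cyl_content.

Let path_sub (E : set path) : measurable E ->
  (cylinder_display.-measurable).-sigma.-measurable (E : set cylinder_algebra).
Proof.
apply: smallest_sub; first exact: smallest_sigma_algebra.
move=> _ [i [B [mB ->]]]; apply: sub_sigma_algebra.
suff : cyl ((fun x : path => x i) @^-1` B) by [].
split.
  by apply: sub_sigma_algebra; exists i, B.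
by exists i => x z xz; rewrite /preimage/= xz.
Qed.

Let ext0 : cyl_extension set0 = 0.
Proof. exact: measure0. Qed.

Let ext_ge0 E : 0 <= cyl_extension E.
Proof. exact: measure_ge0. Qed.

Let ext_sigma_additive : semi_sigma_additive cyl_extension.
Proof.
move=> F mF tF mUF; apply: measure_semi_sigma_additive => //.
  by move=> i; exact: path_sub.
exact: path_sub.
Qed.

HB.instance Definition _ := isMeasure.Build _ path R cyl_extension
  ext0 ext_ge0 ext_sigma_additive.

Let extE E : cyl E -> cyl_extension E = cyl_content E.
Proof. by move=> cE; rewrite /cyl_extension /measure_extension measurable_mu_extE. Qed.

Let cylT : cyl setT.
Proof. by split => //; exists 0%N. Qed.

Let ext_setT : cyl_extension setT = 1.
Proof.
rewrite (extE cylT) /cyl_content.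
have -> : cond 0 setT = cst 1.
  by rewrite (cond_ind cylT (n := 0%N))//; apply/funext => x; rewrite /indE indicT.
by rewrite integral_cst// mul1e; exact: probability_setT.
Qed.

HB.instance Definition _ := Measure_isProbability.Build _ path R cyl_extension
  ext_setT.

Let iter_rect m k (A : nat -> set S) x :
  iter_step k m (indE [set z | forall i, (i <= k + m)%N -> A i (z i)]) x =
  (\1_[set z : path | forall i, (i <= k)%N -> A i (z i)] x)%:E *
  chain_prob kappa m (fun i => A (k + i.+1)%N) (x k).
Proof.
elim: m k x => [|m IH] k x; first by rewrite /= addn0 mule1.
rewrite /= /step addnS -addSn.
under eq_integral => s _ do rewrite IH.
have -> : (fun i => A (k + i.+2)%N) = (fun i => A (k.+1 + i.+1)%N).
  by apply/funext => i; rewrite addSnnS.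
rewrite [in RHS]integral_mkcond.
have [kA|kA] := boolP (x \in [set z : path | forall i, (i <= k)%N -> A i (z i)]).
  rewrite indicE kA mul1e; apply: eq_integral => s _.
  rewrite addn1 patchE indicE /upd eqxx.
  have -> : ((fun i => if i == k.+1 then s else x i) \in
      [set z : path | forall i, (i <= k.+1)%N -> A i (z i)]) = (s \in A k.+1).
    apply/idP/idP; rewrite !inE/= => H.
      by have := H k.+1 (leqnn _); rewrite eqxx.
    move=> i; case: eqP => [-> //|/eqP ik1 ik].
    by move: kA; rewrite inE/=; apply; lia.
  by case: ifPn => _; rewrite ?mul1e ?mul0e.
rewrite indicE (negbTE kA) mul0e integral0_eq// => s _.
rewrite indicE memNset ?mul0e// => H; move/negP: kA; apply; rewrite inE => i ik.
by have := H i (leqW ik); rewrite /upd ltn_eqF.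
Qed.

Theorem ionescu_tulcea : exists P, is_path_law kappa mu P.
Proof.
exists cyl_extension => n A mA.
set E : set path := [set x : nat -> S | forall i, (i <= n)%N -> A i (x i)].
have dE : dep n E.
  by move=> x y xy; apply/propext; split => Ax i ni; have := Ax i ni; rewrite xy.
have cE : cyl E by split; [exact: measurable_rectangle|exists n].
rewrite [LHS](extE cE) /cyl_content [RHS]integral_mkcond; apply: eq_integral => s _.
rewrite (condE (m := n) cE dE)// (iter_rect n 0 A) patchE indicE.
have -> : (konst s \in [set z : path | forall i, (i <= 0)%N -> A i (z i)]) = (s \in A 0%N).
  apply/idP/idP; rewrite !inE/= => H; first exact: H.
  by move=> i; rewrite leqn0 => /eqP ->.
by case: ifPn => _; rewrite ?mul1e ?mul0e.
Qed.

Theorem is_path_law_unique (P Q : probability path R) :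
  is_path_law kappa mu P -> is_path_law kappa mu Q ->
  forall E, measurable E -> P E = Q E.
Proof.
move=> lP lQ E mE.
pose G : set (set path) := [set E | exists n A, (forall i, measurable (A i)) /\
  E = [set x : nat -> S | forall i, (i <= n)%N -> A i (x i)]].
have GT : G setT by exists 0%N, (fun=> setT); split => //; apply/seteqP.
apply: (measure_unique G (fun=> setT)) => //.
- apply/seteqP; split.
    apply: smallest_sub; first exact: smallest_sigma_algebra.
    move=> _ [i [B [mB ->]]]; apply: sub_sigma_algebra.
    exists i, (fun j => if j == i then B else setT); split.
      by move=> j; case: eqP.
    apply/seteqP; split => [x Bx j|x /(_ i (leqnn _))]; last by rewrite eqxx.
    by case: eqP => // ->.
  apply: smallest_sub; first exact: sigma_algebra_measurable.
  by move=> _ [n [A [mA ->]]]; exact: measurable_rectangle.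
- move=> _ _ [n [A [mA ->]]] [m [B [mB ->]]].
  exists (maxn n m), (fun i => (if (i <= n)%N then A i else setT) `&`
                              (if (i <= m)%N then B i else setT)); split.
    by move=> i; apply: measurableI; case: ifP.
  apply/seteqP; split => [x [Ax Bx] i _|x AB].
    by split; case: ifPn => // ?; [exact: Ax|exact: Bx].
  split => i im; have [|] := AB i; rewrite ?im//; lia.
- by apply/seteqP; split => // x _; exists 0%N.
- by move=> _ [n [A [mA ->]]]; exact: etrans (lP n A mA) (esym (lQ n A mA)).
- by move=> _; rewrite -ge0_fin_numE//; exact: fin_num_measure.
Qed.
End ionescu_tulcea.

Definition path_law d (S : measurableType d) (R : realType)
    (kappa : R.-pker S ~> S) (mu : probability S R) :
    probability (path_space S) R :=
  sval (cid (ionescu_tulcea kappa mu)).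

Lemma path_lawP d (S : measurableType d) (R : realType)
    (kappa : R.-pker S ~> S) (mu : probability S R) :
  is_path_law kappa mu (path_law kappa mu).
Proof. exact: svalP (cid (ionescu_tulcea kappa mu)). Qed.

Section one_step.
Context d (S : measurableType d) (R : realType).
Variables (kappa : R.-pker S ~> S) (mu : probability S R).

Definition one_step (A : set S) : \bar R := \int[mu]_s kappa s A.

Let one_step0 : one_step set0 = 0.
Proof. by apply: integral0_eq => s _; exact: measure0. Qed.

Let one_step_ge0 A : 0 <= one_step A.
Proof. exact: integral_ge0. Qed.

Let one_step_sigma_additive : semi_sigma_additive one_step.
Proof.
move=> F mF tF mUF.
have -> : one_step (\bigcup_n F n) = \sum_(i <oo) one_step (F i).
  rewrite -integral_nneseries//; last first.
    by move=> i; exact: measurable_kernel.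
  apply: eq_integral => s _; apply/esym/cvg_lim => //.
  exact: measure_semi_sigma_additive.
by apply: is_cvg_nneseries.
Qed.

HB.instance Definition _ := isMeasure.Build _ S R one_step
  one_step0 one_step_ge0 one_step_sigma_additive.

Let one_stepT : one_step [set: S] = 1.
Proof.
rewrite /one_step; under eq_integral do rewrite prob_kernel.
by rewrite integral_cst// mul1e; exact: probability_setT.
Qed.

HB.instance Definition _ := Measure_isProbability.Build _ S R one_step one_stepT.

End one_step.

Definition attractor d (S : measurableType d) (R : realType)
    (kappa : R.-pker S ~> S) (B : set S) :=
  measurable B /\
  forall mu : probability S R, path_law kappa mu (eventually_in B) = 1.

Section abstraction.
Context d1 d2 (S1 : measurableType d1) (S2 : measurableType d2) (R : realType).
Variables (kappa1 : R.-pker S1 ~> S1) (kappa2 : R.-pker S2 ~> S2).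
Variable alpha : {mfun S1 >-> S2}.

(* [distribution mu alpha] is the pushforward of [mu] by [alpha], packaged as a
   probability measure. *)
Definition abstraction :=
  forall (mu : probability S1 R) (A : set S2), measurable A ->
    distribution (one_step kappa1 mu) alpha A = 0 <->
    one_step kappa2 (distribution mu alpha) A = 0.

Definition sound :=
  forall (mu : probability S1 R) (B : set S2), measurable B ->
    path_law kappa2 (distribution mu alpha) (eventually_in B) = 1 ->
    path_law kappa1 mu (eventually_in (alpha @^-1` B)) = 1.

Definition sound_abstraction := abstraction /\ sound.

End abstraction.

(* Main.v *)
Require Import Defs.
From mathcomp Require Import all_boot all_order all_algebra.
From mathcomp Require Import all_classical all_reals all_analysis.
Local Open Scope classical_set_scope.

Theorem proposition34 (R : realType) (d1 d2 : measure_display)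
    (S1 : measurableType d1) (S2 : measurableType d2)
    (kappa1 : R.-pker S1 ~> S1) (kappa2 : R.-pker S2 ~> S2)
    (alpha : {mfun S1 >-> S2}) (A : set S2) :
  sound_abstraction kappa1 kappa2 alpha ->
  attractor kappa2 A ->
  attractor kappa1 (alpha @^-1` A).
Proof.
move=> [_ snd] [mA attrA]; split => [|mu].
  (* Measurability of [alpha] speaks of preimages intersected with its domain, here the whole space,
     hence the rewriting by [setTI]. *)
  by rewrite -[X in measurable X]setTI; exact: measurable_funPT.
(* An attractor is reached almost surely from every initial law, in particular from the pushforward
   [distribution mu alpha]; soundness pulls this back to the chain started from [mu]. *)
by apply: snd => //; exact: attrA.
Qed.
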